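(* Let $r=m=3$. Let $a_{ij}\in\mathbb{C}$ ($1\le i,j\le 3$) and $f_i=\sum_{j=1}^3 a_{ij}z_j$. Let $S_1$ be the family $(z_1^2,z_2^2,z_3^2,f_1^2,f_2^2,f_3^2)$ in $\mathbb{C}[z_1,z_2,z_3]$ and $S_3$ the family of the $20$ products of three distinct members of $S_1$. Then $S_3$ is linearly independent if and only if $S_1$ is linearly independent.
   Context: For a finite family $S_1=(p_1,\dots,p_l)$ of polynomials and $1\le k\le l$, $S_k$ denotes the family $(p_{i_1}p_{i_2}\cdots p_{i_k})_{1\le i_1<\dots<i_k\le l}$ of the $\binom{l}{k}$ products of $k$ members of $S_1$ with distinct indices. A family is linearly independent (over $\mathbb{C}$) if no nontrivial $\mathbb{C}$-linear combination of its members (counted with their indices, so repeated members make the family dependent) vanishes. *)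

(* Defs.v *)
From HB Require Import structures.
From mathcomp Require Import all_boot all_order all_algebra.
From mathcomp Require Import reals complex.
From mathcomp Require Import mpoly.
Set Implicit Arguments. Unset Strict Implicit. Unset Printing Implicit Defensive.
Import Order.TTheory GRing.Theory Num.Theory.
Local Open Scope ring_scope.

(* Linear independence over the scalar ring K of a family F indexed by a
   finite type I (repeated members make the family dependent). *)
Definition lin_indep (K : nzRingType) (V : lmodType K) (I : finType)
  (F : I -> V) : Prop :=
  forall c : I -> K, \sum_(i : I) c i *: F i = 0 -> forall i, c i = 0.

Definition ksubset (l k : nat) := {A : {set 'I_l} | #|A| == k}.

Definition Sk (R : comNzRingType) (l k : nat) (S1 : 'I_l -> R)
  (A : ksubset l k) : R :=
  \prod_(i in sval A) S1 i.

Definition lin_forms (C : comNzRingType) (a : 'M[C]_3) (i : 'I_3) : {mpoly C[3]} :=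
  \sum_(j < 3) a i j *: 'X_j.

Definition S1_fam (C : comNzRingType) (a : 'M[C]_3) (k : 'I_6) : {mpoly C[3]} :=
  match split (k : 'I_(3 + 3)) with
  | inl i => 'X_i ^+ 2
  | inr i => lin_forms a i ^+ 2
  end.

(* Main.v *)
Require Import Defs.
From HB Require Import structures.
From mathcomp Require Import all_boot all_order all_algebra.
From mathcomp Require Import ring.
From mathcomp Require Import reals complex.
From mathcomp Require Import mpoly.
Set Implicit Arguments. Unset Strict Implicit. Unset Printing Implicit Defensive.
Import Order.TTheory GRing.Theory Num.Theory.
Local Open Scope ring_scope.

(* Regard the six linear forms as points l_0, ..., l_5 of the projective plane,
   with brackets [ijk] = det(l_i, l_j, l_k). Their squares are dependent exactly
   when the points lie on a conic, i.e. when a certain determinant D vanishes.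
   Both directions rest on the identity

     sum_A sgn(A) [A] [A^c]^3 (prod_(i in A) l_i)^2 = - 6 D prod_i l_i,

   where A runs over the triples. If D = 0 it is a relation among the triple
   products, and it is nontrivial unless four of the points are collinear, in
   which case four of the squares are already dependent.
   Conversely, given a relation sum_A c_A (prod_(i in A) l_i)^2 = 0, expand it
   around the common zero of l_i and l_j. With e_A = c_(A^c) / [A]^2, order 0
   gives sum_m e_ijm = 0, hence e_(A^c) = - e_A, and order 1 gives
   sum_m e_ijm l_m / [ijm] = 0, hence e_A is proportional to
   sgn(A) [A] [A^c]. The identity then turns the relation into e_A D = 0.
   If [ijk] = 0, order 0 at the common zero of l_i and l_j says instead that the
   coefficient of the complement of ijk vanishes, and the sum rule reappears at
   order 2; the missing proportionality for the pair ij is obtained from the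
   complementary pair by e_(A^c) = - e_A. *)

(** * Enumeration of the subsets of a given size *)

Section ksubsets.
Variable I : finType.
Implicit Types (s : seq I) (A : {set I}).

(** An explicit list, so that a sum over the triples of six points unfolds by computation into its
    twenty terms, in lexicographic order. *)
Fixpoint ksubsets k s : seq {set I} :=
  match k, s with
  | 0%N, _ => [:: set0]
  | k'.+1, [::] => [::]
  | k'.+1, x :: s' => [seq x |: A | A <- ksubsets k' s'] ++ ksubsets k s'
  end.

Lemma mem_ksubsets k s A : uniq s ->
  (A \in ksubsets k s) = (A \subset s) && (#|A| == k)%N.
Proof.
elim: s k A => [|x s IHs] [|k] A /=; rewrite ?inE.
- move=> _; rewrite cards_eq0 andbC; case: eqP => // ->.
  by apply/esym/subsetP => y; rewrite inE.
- move=> _; apply/esym/negbTE/negP => /andP[/subsetP sA /eqP cA].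
  by have /card_gt0P[y /sA] : (0 < #|A|)%N by rewrite cA.
- move=> _; rewrite cards_eq0 andbC; case: eqP => // ->.
  by apply/esym/subsetP => y; rewrite inE.
move=> /andP[xs us]; rewrite mem_cat IHs //.
have sub (B : {set I}) : x \notin B -> (B \subset x :: s) = (B \subset s).
  move=> xB; apply/idP/idP => /subsetP sB; apply/subsetP => y yB; last first.
    by rewrite inE sB ?orbT.
  by have := sB _ yB; rewrite inE => /orP[/eqP yx|//]; rewrite -yx yB in xB.
have [xA|xA] := boolP (x \in A); last first.
  rewrite sub //; case: mapP => // -[B _ eA].
  by rewrite eA setU11 in xA.
have -> : (A \subset s) = false.
  by apply/negbTE/subsetPn; exists x.
rewrite orbF; apply/mapP/andP => [[B]|[sA /eqP cA]].
  rewrite IHs // => /andP[/subsetP sB /eqP cB] ->.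
  have xB : x \notin B by apply: contra xs => /sB.
  rewrite cardsU1 xB cB; split=> //; apply/subsetP => y.
  by rewrite !inE => /orP[->//|/sB ->]; rewrite orbT.
exists (A :\ x); last by rewrite setD1K.
rewrite IHs // -eqSS -cA (cardsD1 x A) xA eqxx andbT; apply/subsetP => y.
rewrite !inE => /andP[yx /(subsetP sA)].
by rewrite inE (negbTE yx).
Qed.

Lemma ksubsets_uniq k s : uniq s -> uniq (ksubsets k s).
Proof.
elim: s k => [|x s IHs] [|k] //= /andP[xs us].
rewrite cat_uniq !IHs // andbT map_inj_in_uniq ?IHs //=.
  apply/hasPn => A; rewrite mem_ksubsets // => /andP[/subsetP sA _].
  apply/mapP => -[B _ eA]; case/negP: xs; apply: sA.
  by rewrite eA setU11.
have xN (B : {set I}) : B \in ksubsets k s -> x \notin B.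
  rewrite mem_ksubsets // => /andP[/subsetP sB _].
  by apply: contra xs => /sB.
by move=> B1 B2 /xN x1 /xN x2 /(congr1 (fun B => B :\ x)); rewrite !setU1K.
Qed.
End ksubsets.

(** * Square-free cubic forms in six variables and their restriction to a line *)

Definition cubic (K : comNzRingType) (I : Type) (C : I -> I -> I -> K) (x : I -> K)
    (i j m n p q : I) : K :=
  C i j m * (x i * x j * x m) + C i j n * (x i * x j * x n)
  + C i j p * (x i * x j * x p) + C i j q * (x i * x j * x q)
  + C i m n * (x i * x m * x n) + C i m p * (x i * x m * x p)
  + C i m q * (x i * x m * x q) + C i n p * (x i * x n * x p)
  + C i n q * (x i * x n * x q) + C i p q * (x i * x p * x q)
  + C j m n * (x j * x m * x n) + C j m p * (x j * x m * x p)
  + C j m q * (x j * x m * x q) + C j n p * (x j * x n * x p)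
  + C j n q * (x j * x n * x q) + C j p q * (x j * x p * x q)
  + C m n p * (x m * x n * x p) + C m n q * (x m * x n * x q)
  + C m p q * (x m * x p * x q) + C n p q * (x n * x p * x q).

Lemma poly_eval_eq0 (K : numDomainType) (p : {poly K}) :
  (forall t, p.[t] = 0) -> p = 0.
Proof.
move=> p0; apply/eqP; apply: contraT => nz.
(* In characteristic zero 0, 1, 2, ... are distinct, and [size p] roots are one more than the degree
   allows. *)
have := @max_poly_roots _ p [seq i%:R | i <- iota 0 (size p)] nz.
rewrite size_map size_iota ltnn map_inj_uniq ?iota_uniq; last first.
  by move=> x y /eqP; rewrite eqr_nat => /eqP.
by move=> -> //; apply/allP => x _; rewrite /root p0.
Qed.


Lemma horner_cubic (K : comNzRingType) (I : Type) (C : I -> I -> I -> {poly K})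
    (x : I -> {poly K}) i j m n p q t :
  (cubic C x i j m n p q).[t] =
  cubic (fun a b c => (C a b c).[t]) (fun a => (x a).[t]) i j m n p q.
Proof. by rewrite /cubic !(hornerD, hornerM). Qed.

Section line.
Variables (K : numFieldType) (I : Type) (C : I -> I -> I -> K) (A B : I -> K).
Variables i j m n p q : I.
Hypothesis C0 : forall t, cubic C (fun a => (A a + B a * t) ^+ 2) i j m n p q = 0.

Let lin a : {poly K} := (A a)%:P + (B a)%:P * 'X.

Let P0 : cubic (fun a b c => (C a b c)%:P) (fun a => lin a ^+ 2) i j m n p q = 0.
Proof.
apply: poly_eval_eq0 => t; rewrite -[RHS](C0 t) horner_cubic /cubic /lin.
by rewrite !(hornerC, horner_exp, hornerD, hornerM, hornerX).
Qed.

Let lin0 a : (lin a)`_0 = A a.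
Proof. by rewrite coefD coefC coefMX addr0. Qed.
Let lin1 a : (lin a)`_1 = B a.
Proof. by rewrite coefD coefC coefMX coefC add0r. Qed.
Let lin2 a : (lin a)`_2 = 0.
Proof. by rewrite coefD coefC coefMX coefC add0r. Qed.

Let coef1 (f g : {poly K}) : (f * g)`_1 = f`_0 * g`_1 + f`_1 * g`_0.
Proof. by rewrite coefM !big_ord_recr big_ord0 /= add0r. Qed.
Let coef2 (f g : {poly K}) : (f * g)`_2 = f`_0 * g`_2 + f`_1 * g`_1 + f`_2 * g`_0.
Proof. by rewrite coefM !big_ord_recr big_ord0 /= add0r. Qed.

(** The product of squares is the square of g = [lin a * lin b * lin c], so its coefficient of order
    1 is 2 g_0 g_1, and that of order 2 is g_1^2 + 2 g_0 g_2. *)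
Let term1 (k : K) a b c :
  (k%:P * (lin a ^+ 2 * lin b ^+ 2 * lin c ^+ 2))`_1
  = 2%:R * (k * (A a * A b * A c *
      (B a * A b * A c + A a * B b * A c + A a * A b * B c))).
Proof. by rewrite coefCM !expr2 !(coef1, coef0M) !lin0 !lin1; ring. Qed.

Let term2 (k : K) a b c :
  (k%:P * (lin a ^+ 2 * lin b ^+ 2 * lin c ^+ 2))`_2
  = k * ((B a * A b * A c + A a * B b * A c + A a * A b * B c) ^+ 2
    + 2%:R * (A a * A b * A c) * (B a * B b * A c + B a * A b * B c + A a * B b * B c)).
Proof.
by rewrite coefCM !expr2 !(coef2, coef1, coef0M) !lin0 !lin1 !lin2; ring.
Qed.

(** Terms through i or j vanish to order 2 at t = 0, so orders 0 and 1 see only the four triples of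
    m, n, p, q. *)
Lemma cubic_line0 : A i = 0 -> A j = 0 ->
  C m n p * (A m * A n * A p) ^+ 2 + C m n q * (A m * A n * A q) ^+ 2
  + C m p q * (A m * A p * A q) ^+ 2 + C n p q * (A n * A p * A q) ^+ 2 = 0.
Proof.
by move=> Ai Aj; rewrite -[RHS](C0 0) /cubic Ai Aj !mulr0 !addr0; ring.
Qed.

Lemma cubic_line1 : A i = 0 -> A j = 0 ->
  C m n p * (A m * A n * A p * (B m * A n * A p + A m * B n * A p + A m * A n * B p)) +
  C m n q * (A m * A n * A q * (B m * A n * A q + A m * B n * A q + A m * A n * B q)) +
  C m p q * (A m * A p * A q * (B m * A p * A q + A m * B p * A q + A m * A p * B q)) +
  C n p q * (A n * A p * A q * (B n * A p * A q + A n * B p * A q + A n * A p * B q)) = 0.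
Proof.
move=> Ai Aj; have : (0 : {poly K})`_1 = 0 by rewrite coef0.
rewrite -P0 /cubic !coefD !term1 Ai Aj => E.
by apply: (mulfI (_ : 2%:R != 0)); rewrite ?pnatr_eq0 // mulr0 -[RHS]E; ring.
Qed.

(** A term vanishes to at least twice the number of its indices among i, j, m. With the coefficient
    of n, p, q zero, order 2 sees exactly the terms with one such index. *)
Lemma cubic_line2 : A i = 0 -> A j = 0 -> A m = 0 -> C n p q = 0 ->
  B i ^+ 2 * (C i n p * (A n * A p) ^+ 2 + C i n q * (A n * A q) ^+ 2
    + C i p q * (A p * A q) ^+ 2)
  + B j ^+ 2 * (C j n p * (A n * A p) ^+ 2 + C j n q * (A n * A q) ^+ 2
    + C j p q * (A p * A q) ^+ 2)
  + B m ^+ 2 * (C m n p * (A n * A p) ^+ 2 + C m n q * (A n * A q) ^+ 2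
    + C m p q * (A p * A q) ^+ 2)
  = 0.
Proof.
move=> Ai Aj Am C1; have : (0 : {poly K})`_2 = 0 by rewrite coef0.
by rewrite -P0 /cubic !coefD !term2 Ai Aj Am C1 => E; rewrite -[RHS]E; ring.
Qed.
End line.

(** * Brackets of points and triples of indices *)

Definition bracket (K : comNzRingType) (u v w : K * K * K) : K :=
  u.1.1 * (v.1.2 * w.2 - v.2 * w.1.2) - u.1.2 * (v.1.1 * w.2 - v.2 * w.1.1)
  + u.2 * (v.1.1 * w.1.2 - v.1.2 * w.1.1).
Definition dot (K : comNzRingType) (u v : K * K * K) : K :=
  u.1.1 * v.1.1 + u.1.2 * v.1.2 + u.2 * v.2.
Definition cross (K : comNzRingType) (u v : K * K * K) : K * K * K :=
  (u.1.2 * v.2 - u.2 * v.1.2, u.2 * v.1.1 - u.1.1 * v.2,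
   u.1.1 * v.1.2 - u.1.2 * v.1.1).

(** The trailing [set0] reproduces the shape computed by [ksubsets], whose entries can then be
    folded back into [tri]. *)
Definition tri (I : finType) (i j k : I) : {set I} := i |: (j |: (k |: set0)).

Lemma triC (I : finType) (i j k : I) : tri i j k = tri j i k.
Proof. by rewrite /tri setUCA. Qed.
Lemma triAC (I : finType) (i j k : I) : tri i j k = tri i k j.
Proof. by rewrite /tri (setUCA [set j]). Qed.

Lemma in_tri (I : finType) (i j k x : I) : (x \in tri i j k) = (x \in [:: i; j; k]).
Proof. by rewrite /tri !inE orbF. Qed.

(** Two lists are rearrangements of each other when all their counts agree, and here this is an
    identity between sums of natural numbers. *)
Ltac permute_uniq U :=
  by apply: etrans U; apply: perm_uniq; apply/permP => ? /=; ring.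

Lemma mem_all6 (i j m n p q x : 'I_6) : uniq [:: i; j; m; n; p; q] ->
  x \in [:: i; j; m; n; p; q].
Proof.
move=> U; have /subset_cardP/(_ _) := etrans (card_uniqP U) (esym (card_ord 6)).
by move=> /(_ (subset_predT _)) ->.
Qed.

Lemma setC_tri (i j m n p q : 'I_6) : uniq [:: i; j; m; n; p; q] ->
  ~: tri i j m = tri n p q.
Proof.
move=> U; apply/setP => x; rewrite inE !in_tri.
have := mem_all6 x U; rewrite -[X in x \in X]/([:: i; j; m] ++ [:: n; p; q]).
move: U; rewrite -[X in uniq X]/([:: i; j; m] ++ [:: n; p; q]) cat_uniq.
rewrite mem_cat => /and3P[_ /hasPn H _].
case: (boolP (x \in [:: n; p; q])) => [/H/negP/negP->//|_].
by rewrite orbF => ->.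
Qed.

(** * Weights of a relation among the triple products *)

Section config.
Variables (K : numFieldType) (l : 'I_6 -> K * K * K) (c : {set 'I_6} -> K).
Local Notation b i j k := (bracket (l i) (l j) (l k)).
Hypothesis rel : forall i j m n p q z, uniq [:: i; j; m; n; p; q] ->
  cubic (fun x y w => c (tri x y w)) (fun x => dot (l x) z ^+ 2) i j m n p q = 0.
(** Besides forbidding four collinear points, this makes any two points distinct: both brackets
    vanish when l_i and l_j are proportional. *)
Hypothesis not_collinear4 : forall i j k m, uniq [:: i; j; k; m] ->
  b i j k = 0 -> b i j m != 0.

(* When [ijk] = 0 this is 0 by the convention on division, and so is the
   numerator: see [coef_collinear]. *)
Definition weight i j k := c (~: tri i j k) / b i j k ^+ 2.

Lemma bracketC (u v w : K * K * K) : bracket v u w = - bracket u v w.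
Proof. by rewrite /bracket; ring. Qed.
Lemma bracketAC (u v w : K * K * K) : bracket u w v = - bracket u v w.
Proof. by rewrite /bracket; ring. Qed.
Lemma dot_crossE (u v w : K * K * K) : dot w (cross u v) = bracket u v w.
Proof. by rewrite /dot /cross /bracket /=; ring. Qed.
Lemma bracket_id (u v : K * K * K) : bracket u v u = 0.
Proof. by rewrite /bracket; ring. Qed.
Lemma bracket_idr (u v : K * K * K) : bracket u v v = 0.
Proof. by rewrite /bracket; ring. Qed.

Lemma weightC i j k : weight i j k = weight j i k.
Proof. by rewrite /weight triC bracketC sqrrN. Qed.
Lemma weightAC i j k : weight i j k = weight i k j.
Proof. by rewrite /weight triAC bracketAC sqrrN. Qed.

Lemma rel_line z u i j m n p q : uniq [:: i; j; m; n; p; q] -> forall t,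
  cubic (fun x y w => c (tri x y w))
    (fun x => (dot (l x) z + dot (l x) u * t) ^+ 2) i j m n p q = 0.
Proof.
move=> U t; rewrite -[RHS](rel (z.1.1 + u.1.1 * t, z.1.2 + u.1.2 * t, z.2 + u.2 * t) U).
have E x : dot (l x) (z.1.1 + u.1.1 * t, z.1.2 + u.1.2 * t, z.2 + u.2 * t)
  = dot (l x) z + dot (l x) u * t by rewrite /dot /=; ring.
by rewrite /cubic !E.
Qed.

(** At the common zero of l_i and l_j the form l_m vanishes too, so one term survives; its three
    brackets are nonzero as no four points are collinear. *)
Lemma coef_collinear i j m n p q : uniq [:: i; j; m; n; p; q] ->
  b i j m = 0 -> c (tri n p q) = 0.
Proof.
move=> U bm; have := cubic_line0 (rel_line (cross (l i) (l j)) (0, 0, 0) U).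
rewrite !dot_crossE bracket_id bracket_idr bm => /(_ erefl erefl).
rewrite ?(mul0r, mulr0, expr0n, add0r) /= ?(mulr0, add0r) => /eqP.
move: U; rewrite -[X in uniq X]/([:: i; j; m] ++ [:: n; p; q]) => U.
have nz x : x \in [:: n; p; q] -> b i j x != 0.
  move=> xs; apply: not_collinear4 bm.
  move: U; rewrite cat_uniq => /and3P[U1 /hasPn/(_ _ xs) xN _].
  by rewrite -[X in uniq X]/([:: i; j; m] ++ [:: x]) cat_uniq U1 /= orbF xN.
rewrite mulf_eq0 sqrf_eq0 !mulf_eq0.
by rewrite !(negbTE (nz _ _)) ?inE ?eqxx ?orbT // !orbF => /eqP.
Qed.

(** This inverts the definition of [weight]; when [ijm] = 0 both sides are zero by
    [coef_collinear]. *)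
Lemma weight_coef i j m n p q : uniq [:: i; j; m; n; p; q] ->
  c (tri n p q) = weight i j m * b i j m ^+ 2.
Proof.
move=> U; rewrite /weight (setC_tri U).
have [b0|b0] := eqVneq (b i j m) 0; first by rewrite (coef_collinear U b0) !mul0r.
by rewrite divfK // sqrf_eq0.
Qed.


(** Order 2 at the common zero of l_i, l_j, l_m gives, for each direction, one linear equation in
    three partial sums. Three directions determine them, and the sum attached to m is the wanted one
    up to nonzero brackets. *)
Lemma weight_pair_sum_collinear i j m n p q : uniq [:: i; j; m; n; p; q] ->
  b i j m = 0 -> weight i j n + weight i j p + weight i j q = 0.
Proof.
move=> U bm.
(* The 3 x 3 system has zero diagonal and determinant 2 (X Y Z)^2; the combination below isolates
   [am]. *)
have solve (X Y Z ai aj am : K) : X != 0 -> Y != 0 -> Z != 0 ->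
    X ^+ 2 * aj + Y ^+ 2 * am = 0 -> X ^+ 2 * ai + Z ^+ 2 * am = 0 ->
    Y ^+ 2 * ai + Z ^+ 2 * aj = 0 -> am = 0.
  move=> X0 Y0 Z0 E1 E2 E3; apply: (mulfI (_ : 2%:R * (Y ^+ 2 * Z ^+ 2) != 0)).
    by rewrite !(mulf_neq0, expf_neq0) ?pnatr_eq0.
  rewrite mulr0.
  transitivity (Y ^+ 2 * (X ^+ 2 * ai + Z ^+ 2 * am)
    + Z ^+ 2 * (X ^+ 2 * aj + Y ^+ 2 * am)
    - X ^+ 2 * (Y ^+ 2 * ai + Z ^+ 2 * aj)); first by ring.
  by rewrite E1 E2 E3 !mulr0 subr0 addr0.
have U4 : uniq [:: i; j; m; n].
  by move: U; rewrite (cat_uniq [:: i; j; m; n] [:: p; q]) => /andP[].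
have Xn : b i j n != 0 by exact: not_collinear4 bm.
have Xp : b i j p != 0.
  apply: not_collinear4 bm.
  suff: uniq [:: i; j; m; p; n; q].
    by rewrite (cat_uniq [:: i; j; m; p] [:: n; q]) => /andP[].
  by permute_uniq U.
have Xq : b i j q != 0.
  apply: not_collinear4 bm.
  suff: uniq [:: i; j; m; q; n; p].
    by rewrite (cat_uniq [:: i; j; m; q] [:: n; p]) => /andP[].
  by permute_uniq U.
have Yn : b i m n != 0.
  apply: (@not_collinear4 i m j n); first by permute_uniq U4.
  by rewrite bracketAC bm oppr0.
have Zn : b j m n != 0.
  apply: (@not_collinear4 j m i n); first by permute_uniq U4.
  by rewrite bracketAC bracketC bm !oppr0.
(* The directions are the common zeros of l_n with l_i, l_j and l_m in turn; each removes one of the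
   three partial sums. *)
have Q u := cubic_line2 (rel_line (cross (l i) (l j)) u U).
move: {Q}(Q (cross (l i) (l n))) (Q (cross (l j) (l n))) (Q (cross (l m) (l n))).
rewrite !dot_crossE !bracket_id !bracket_idr bm (coef_collinear U bm).
move=> /(_ erefl erefl erefl erefl) Qi /(_ erefl erefl erefl erefl) Qj
  /(_ erefl erefl erefl erefl) Qm.
have := solve (b i j n) (b i m n) (b j m n) _ _ _ Xn Yn Zn.
move: Qi Qj Qm; rewrite ?expr0n ?mul0r ?add0r ?addr0.
rewrite !(bracketAC _ _ (l n)).
rewrite (bracketC (l i) (l j)) (bracketC (l i) (l m)) (bracketC (l j) (l m)).
rewrite !sqrrN => Qi Qj Qm /(_ _ _ _ Qi Qj Qm).
rewrite (@weight_coef i j q m n p) ?(@weight_coef i j p m n q)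
  ?(@weight_coef i j n m p q); try by permute_uniq U.
move=> E; apply: (mulfI (_ : (b i j n * b i j p * b i j q) ^+ 2 != 0)).
  by rewrite !(expf_neq0, mulf_neq0).
by rewrite mulr0 -[RHS]E; ring.
Qed.

Lemma weight_collinear i j k : b i j k = 0 -> weight i j k = 0.
Proof. by move=> b0; rewrite /weight b0 expr0n invr0 mulr0. Qed.

(** If no bracket through i, j vanishes, this is order 0 divided by the square of the product of the
    four brackets. Otherwise the weight of a collinear triple is zero and the collinear case gives
    the other three. *)
Lemma weight_pair_sum i j m n p q : uniq [:: i; j; m; n; p; q] ->
  weight i j m + weight i j n + weight i j p + weight i j q = 0.
Proof.
move=> U; have [Xm|Xm] := eqVneq (b i j m) 0.
  by rewrite (weight_collinear Xm) add0r; apply: weight_pair_sum_collinear Xm.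
have [Xn|Xn] := eqVneq (b i j n) 0.
  rewrite (weight_collinear Xn) addr0.
  by apply: (weight_pair_sum_collinear _ Xn); permute_uniq U.
have [Xp|Xp] := eqVneq (b i j p) 0.
  rewrite (weight_collinear Xp) addr0.
  by apply: (weight_pair_sum_collinear _ Xp); permute_uniq U.
have [Xq|Xq] := eqVneq (b i j q) 0.
  rewrite (weight_collinear Xq) addr0.
  by apply: (weight_pair_sum_collinear _ Xq); permute_uniq U.
have := cubic_line0 (rel_line (cross (l i) (l j)) (0, 0, 0) U).
rewrite !dot_crossE bracket_id bracket_idr => /(_ erefl erefl).
rewrite (@weight_coef i j q m n p) ?(@weight_coef i j p m n q)
  ?(@weight_coef i j n m p q) ?(@weight_coef i j m n p q);
  try by permute_uniq U.
move=> E; apply: (mulfI (_ : (b i j m * b i j n * b i j p * b i j q) ^+ 2 != 0)).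
  by rewrite !(expf_neq0, mulf_neq0).
by rewrite mulr0 -[RHS]E; ring.
Qed.

(** Double counting. The six pairs inside ijm or npq contribute 3 times the two weights plus each of
    the eighteen mixed weights once; the nine mixed pairs contribute each mixed weight twice. Twice
    the first total minus the second is 6 times the sum of the two weights. *)
Lemma weight_opp i j m n p q : uniq [:: i; j; m; n; p; q] ->
  weight n p q = - weight i j m.
Proof.
move=> U.
have A1 : weight i j m + weight i j n + weight i j p + weight i j q = 0.
  exact: weight_pair_sum U.
have A2 : weight i j m + weight i m n + weight i m p + weight i m q = 0.
  by rewrite (weightAC i j); apply: weight_pair_sum; permute_uniq U.
have A3 : weight i j m + weight j m n + weight j m p + weight j m q = 0.
  by rewrite (weightC i j) (weightAC j i); apply: weight_pair_sum; permute_uniq U.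
have D1 : weight n p q + weight i n p + weight j n p + weight m n p = 0.
  rewrite 3!(weightC _ n) 3!(weightAC n _ p).
  by apply: weight_pair_sum; permute_uniq U.
have D2 : weight n p q + weight i n q + weight j n q + weight m n q = 0.
  rewrite (weightAC n p) 3!(weightC _ n) 3!(weightAC n _ q).
  by apply: weight_pair_sum; permute_uniq U.
have D3 : weight n p q + weight i p q + weight j p q + weight m p q = 0.
  rewrite (weightC n p) (weightAC p n) 3!(weightC _ p) 3!(weightAC p _ q).
  by apply: weight_pair_sum; permute_uniq U.
have B1 : weight i j n + weight i m n + weight i n p + weight i n q = 0.
  rewrite (weightAC i j) (weightAC i m).
  by apply: weight_pair_sum; permute_uniq U.
have B2 : weight i j p + weight i m p + weight i n p + weight i p q = 0.
  rewrite (weightAC i j) (weightAC i m) (weightAC i n).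
  by apply: weight_pair_sum; permute_uniq U.
have B3 : weight i j q + weight i m q + weight i n q + weight i p q = 0.
  rewrite (weightAC i j) (weightAC i m) (weightAC i n) (weightAC i p).
  by apply: weight_pair_sum; permute_uniq U.
have B4 : weight i j n + weight j m n + weight j n p + weight j n q = 0.
  rewrite (weightC i j) (weightAC j i) (weightAC j m).
  by apply: weight_pair_sum; permute_uniq U.
have B5 : weight i j p + weight j m p + weight j n p + weight j p q = 0.
  rewrite (weightC i j) (weightAC j i) (weightAC j m) (weightAC j n).
  by apply: weight_pair_sum; permute_uniq U.
have B6 : weight i j q + weight j m q + weight j n q + weight j p q = 0.
  rewrite (weightC i j) (weightAC j i) (weightAC j m) (weightAC j n) (weightAC j p).
  by apply: weight_pair_sum; permute_uniq U.
have B7 : weight i m n + weight j m n + weight m n p + weight m n q = 0.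
  rewrite (weightC i m) (weightC j m) (weightAC m i) (weightAC m j).
  by apply: weight_pair_sum; permute_uniq U.
have B8 : weight i m p + weight j m p + weight m n p + weight m p q = 0.
  rewrite (weightC i m) (weightC j m) (weightAC m i) (weightAC m j) (weightAC m n).
  by apply: weight_pair_sum; permute_uniq U.
have B9 : weight i m q + weight j m q + weight m n q + weight m p q = 0.
  rewrite (weightC i m) (weightC j m) (weightAC m i) (weightAC m j)
    (weightAC m n) (weightAC m p).
  by apply: weight_pair_sum; permute_uniq U.
apply/eqP; rewrite -addr_eq0; apply/eqP.
apply: (mulfI (_ : 6%:R != 0)); first by rewrite pnatr_eq0.
rewrite mulr0; move: A1 A2 A3 D1 D2 D3 B1 B2 B3 B4 B5 B6 B7 B8 B9.
set x1 := weight i j m; set y1 := weight n p q.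
move=> A1 A2 A3 D1 D2 D3 B1 B2 B3 B4 B5 B6 B7 B8 B9.
have T (x y : K) : x = 0 -> y = 0 -> x + y = 0 by move=> -> ->; rewrite addr0.
have := T _ _ A1 (T _ _ A2 (T _ _ A3 (T _ _ D1 (T _ _ D2 D3)))).
have := T _ _ B1 (T _ _ B2 (T _ _ B3 (T _ _ B4 (T _ _ B5
  (T _ _ B6 (T _ _ B7 (T _ _ B8 B9))))))).
move=> E1 E2; transitivity (2%:R * 0 - 0 : K); last by ring.
rewrite -[X in _ - X]E1 -[X in _ * X - _]E2; ring.
Qed.

(** Order 1 at the common zero of l_i and l_j, in the direction of the common zero of l_p and l_q:
    only the derivatives of l_m and l_n remain, and the pair sum rule reduces their coefficients to
    the weights of ijm and ijn. *)
Lemma weight_proportional_generic i j m n p q : uniq [:: i; j; m; n; p; q] ->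
  b i j m != 0 -> b i j n != 0 -> b i j p != 0 -> b i j q != 0 ->
  weight i j m * b i j n * b p q m = - (weight i j n * b i j m * b p q n).
Proof.
move=> U Xm Xn Xp Xq.
have := cubic_line1 (rel_line (cross (l i) (l j)) (cross (l p) (l q)) U).
rewrite !dot_crossE !bracket_id !bracket_idr => /(_ erefl erefl).
rewrite (@weight_coef i j q m n p) ?(@weight_coef i j p m n q)
  ?(@weight_coef i j n m p q) ?(@weight_coef i j m n p q);
  try by permute_uniq U.
move: (weight_pair_sum U) => /eqP; rewrite addr_eq0 => /eqP E.
have {E} -> : weight i j q = - (weight i j m + weight i j n + weight i j p).
  by rewrite E opprK.
move=> E; apply/eqP; rewrite -subr_eq0 opprK; apply/eqP.
apply: (mulfI (_ : b i j m * b i j n * (b i j p * b i j q) ^+ 2 != 0)).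
  by rewrite !(expf_neq0, mulf_neq0).
by rewrite mulr0 -[RHS]oppr0 -[in RHS]E; ring.
Qed.

Lemma weight_proportional i j m n p q : uniq [:: i; j; m; n; p; q] ->
  weight i j m * b i j n * b p q m = - (weight i j n * b i j m * b p q n).
Proof.
move=> U.
have [Xm|Xm] := eqVneq (b i j m) 0.
  by rewrite (weight_collinear Xm) Xm !(mul0r, mulr0) oppr0.
have [Xn|Xn] := eqVneq (b i j n) 0.
  by rewrite (weight_collinear Xn) Xn !(mul0r, mulr0) oppr0.
have opp_m : weight i j m = - weight p q n.
  by apply/eqP; rewrite -eqr_oppLR; apply/eqP/esym/weight_opp; permute_uniq U.
have opp_n : weight i j n = - weight p q m.
  by apply/eqP; rewrite -eqr_oppLR; apply/eqP/esym/weight_opp; permute_uniq U.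
(* A zero bracket on the pair pq kills a weight on pq, hence the opposite weight on ij, and both
   sides vanish. *)
have [Ym|Ym] := eqVneq (b p q m) 0.
  by rewrite opp_n (weight_collinear Ym) Ym oppr0 !(mul0r, mulr0) oppr0.
have [Yn|Yn] := eqVneq (b p q n) 0.
  by rewrite opp_m (weight_collinear Yn) Yn oppr0 !(mul0r, mulr0) oppr0.
have [/andP[Xp Xq]|X0] := boolP ((b i j p != 0) && (b i j q != 0)).
  exact: weight_proportional_generic.
(* If p or q lies on the line ij, the other one does not, so neither i nor j lies on the line pq.
   The generic case then applies with the pairs ij and pq exchanged. *)
have Yij : b p q i != 0 /\ b p q j != 0.
  have U4 : uniq [:: i; j; p; q].
    suff: uniq [:: i; j; p; q; m; n].
      by rewrite (cat_uniq [:: i; j; p; q] [:: m; n]) => /andP[].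
    by permute_uniq U.
  have b0 : b i j p = 0 \/ b i j q = 0.
    by move: X0; rewrite negb_and !negbK => /orP[] /eqP; [left|right].
  case: b0 => b0.
    split.
      have: b i p q != 0.
        apply: (@not_collinear4 i p j q); first by permute_uniq U4.
        by rewrite bracketAC b0 oppr0.
      by rewrite bracketC bracketAC opprK.
    have: b j p q != 0.
      apply: (@not_collinear4 j p i q); first by permute_uniq U4.
      by rewrite bracketAC bracketC b0 !oppr0.
    by rewrite bracketC bracketAC opprK.
  split.
    have: b i q p != 0.
      apply: (@not_collinear4 i q j p); first by permute_uniq U4.
      by rewrite bracketAC b0 oppr0.
    by rewrite bracketC bracketAC bracketC oppr_eq0 opprK.
  have: b j q p != 0.
    apply: (@not_collinear4 j q i p); first by permute_uniq U4.
    by rewrite bracketAC bracketC b0 !oppr0.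
  by rewrite bracketC bracketAC bracketC oppr_eq0 opprK.
case: Yij => Yi Yj.
have := @weight_proportional_generic p q m n i j.
move=> /(_ _ Ym Yn Yi Yj) E; rewrite opp_m opp_n.
transitivity (weight p q m * b p q n * b i j m); last by ring.
by rewrite E; [ring | permute_uniq U].
Qed.

(* A signed sum over the ten ways to split six points into two triples; the
   sign of each split is the parity of the corresponding rearrangement. *)
Definition split_sum (L : comNzRingType) (t : L * L * L -> L * L * L -> L * L * L ->
    L * L * L -> L * L * L -> L * L * L -> L) (u1 u2 u3 u4 u5 u6 : L * L * L) : L :=
  t u1 u2 u3 u4 u5 u6 - t u1 u2 u4 u3 u5 u6 + t u1 u2 u5 u3 u4 u6
  - t u1 u2 u6 u3 u4 u5 + t u1 u3 u4 u2 u5 u6 - t u1 u3 u5 u2 u4 u6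
  + t u1 u3 u6 u2 u4 u5 + t u1 u4 u5 u2 u3 u6 - t u1 u4 u6 u2 u3 u5
  + t u1 u5 u6 u2 u3 u4.

(** The contributions of a triple and its complement to the identity, which carry opposite signs
    there. The resulting [split_sum] is the negative of that sum, that is 6 D times the product of
    the six forms. *)
Definition split_term (L : comNzRingType) (z u1 u2 u3 u4 u5 u6 : L * L * L) : L :=
  bracket u1 u2 u3 * bracket u4 u5 u6 *
  ((bracket u1 u2 u3 * (dot u4 z * dot u5 z * dot u6 z)) ^+ 2
   - (bracket u4 u5 u6 * (dot u1 z * dot u2 z * dot u3 z)) ^+ 2).


Lemma bracket_rot (u v w : K * K * K) : bracket v w u = bracket u v w.
Proof. by rewrite /bracket; ring. Qed.

(** Proportionality trades the factor [A] [A^c] times the weight of ijm for the weight of A times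
    [ijm] [npq], up to sign. What remains is [ijm] [npq] times the given relation. *)
Lemma weight_split_sum i j m n p q z : uniq [:: i; j; m; n; p; q] ->
  weight i j m * split_sum (split_term z) (l i) (l j) (l m) (l n) (l p) (l q) = 0.
Proof.
move=> U.
have dist1 x y w : uniq [:: i; j; m; x; y; w] ->
    weight i j m * (b i j x * b m y w) = - (weight i j x * (b i j m * b x y w)).
  move=> V; move: (weight_proportional V).
  by rewrite (bracket_rot (l m) (l y)) (bracket_rot (l x) (l y)) !mulrA.
have dist1' x y w : uniq [:: i; m; j; x; y; w] ->
    weight i j m * (b i m x * b j y w) = weight i m x * (b i j m * b x y w).
  move=> V; move: (weight_proportional V).
  rewrite (bracket_rot (l j) (l y)) (bracket_rot (l x) (l y)).
  by rewrite weightAC (bracketAC (l i) (l j)) mulrA => ->; ring.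
(* A triple sharing only i with ijm is reached through its complement, which shares two points,
   using [weight_opp]. *)
have dist2 x y w : uniq [:: j; m; i; w; x; y] ->
    weight i j m * (b i x y * b j m w) = weight i x y * (b i j m * b x y w).
  move=> V; move: (weight_proportional V).
  rewrite (bracket_rot (l i) (l x)) (bracket_rot (l i) (l j)).
  rewrite (@weight_opp i x y j m w); last by permute_uniq V.
  rewrite (weightAC j m) (weightC j i) => E.
  transitivity (weight i j m * b j m w * b i x y); first by ring.
  by rewrite E; ring.
pose s x y w a d e := (b x y w * (dot (l a) z * dot (l d) z * dot (l e) z)) ^+ 2
   - (b a d e * (dot (l x) z * dot (l y) z * dot (l w) z)) ^+ 2.
(* The given relation, with each triple grouped with its complement. *)
have R : weight i j m * s i j m n p q + weight i j n * s i j n m p q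
    + weight i j p * s i j p m n q + weight i j q * s i j q m n p
    + weight i m n * s i m n j p q + weight i m p * s i m p j n q
    + weight i m q * s i m q j n p + weight i n p * s i n p j m q
    + weight i n q * s i n q j m p + weight i p q * s i p q j m n = 0.
  have pair x y w a d e : uniq [:: x; y; w; a; d; e] ->
      weight x y w * s x y w a d e =
      c (tri a d e) * (dot (l a) z ^+ 2 * dot (l d) z ^+ 2 * dot (l e) z ^+ 2)
      + c (tri x y w) * (dot (l x) z ^+ 2 * dot (l y) z ^+ 2 * dot (l w) z ^+ 2).
    move=> V; rewrite (weight_coef V) (@weight_coef a d e x y w); last first.
      by permute_uniq V.
    by rewrite (weight_opp V) /s; ring.
  rewrite !pair ; try by permute_uniq U.
  rewrite -[RHS](rel z U) /cubic. ring.
have term x y w a d e k : weight i j m * (b x y w * b a d e) = k * (b i j m * b n p q) ->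
    weight i j m * split_term z (l x) (l y) (l w) (l a) (l d) (l e)
    = b i j m * b n p q * (k * s x y w a d e).
  by move=> E; rewrite [RHS]mulrA (mulrC _ k) -E; exact: mulrA.
have pqn : b p q n = b n p q by rewrite bracket_rot.
have pnq : b p n q = - b n p q by rewrite bracketC.
have qnp : b q n p = b n p q by rewrite -bracket_rot.
have nqp : b n q p = - b n p q by rewrite bracketAC.
(* The signs in these nine identities are those of [split_sum], so every term ends up with a plus
   sign, as in [R]. *)
have ijn : weight i j m * (b i j n * b m p q) = - weight i j n * (b i j m * b n p q).
  by rewrite dist1 ?mulNr.
have ijp : weight i j m * (b i j p * b m n q) = weight i j p * (b i j m * b n p q).
  by rewrite dist1 ?pnq ?mulrN ?opprK //; permute_uniq U.
have ijq : weight i j m * (b i j q * b m n p) = - weight i j q * (b i j m * b n p q).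
  by rewrite dist1 ?qnp ?mulNr //; permute_uniq U.
have imn : weight i j m * (b i m n * b j p q) = weight i m n * (b i j m * b n p q).
  by rewrite dist1' //; permute_uniq U.
have imp : weight i j m * (b i m p * b j n q) = - weight i m p * (b i j m * b n p q).
  by rewrite dist1' ?pnq ?mulrN ?mulNr //; permute_uniq U.
have imq : weight i j m * (b i m q * b j n p) = weight i m q * (b i j m * b n p q).
  by rewrite dist1' ?qnp //; permute_uniq U.
have inp : weight i j m * (b i n p * b j m q) = weight i n p * (b i j m * b n p q).
  by rewrite dist2 //; permute_uniq U.
have inq : weight i j m * (b i n q * b j m p) = - weight i n q * (b i j m * b n p q).
  by rewrite dist2 ?nqp ?mulrN ?mulNr //; permute_uniq U.
have ipq : weight i j m * (b i p q * b j m n) = weight i p q * (b i j m * b n p q).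
  by rewrite dist2 ?pqn //; permute_uniq U.
rewrite /split_sum !mulrDr !mulrN (term _ _ _ _ _ _ _ erefl).
rewrite (term _ _ _ _ _ _ _ ijn) (term _ _ _ _ _ _ _ ijp) (term _ _ _ _ _ _ _ ijq).
rewrite (term _ _ _ _ _ _ _ imn) (term _ _ _ _ _ _ _ imp) (term _ _ _ _ _ _ _ imq).
rewrite (term _ _ _ _ _ _ _ inp) (term _ _ _ _ _ _ _ inq) (term _ _ _ _ _ _ _ ipq).
rewrite -[RHS](mulr0 (b i j m * b n p q)) -R; move: (b i j m * b n p q) => T0.
by ring.
Qed.
End config.

(** * Independence of the members selected by a predicate *)

Section indep_on.
Variables (K : nzRingType) (V : lmodType K) (T : finType).

Definition indep_on (P : pred T) (F : T -> V) : Prop :=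
  forall c : T -> K, \sum_(x | P x) c x *: F x = 0 -> forall x, P x -> c x = 0.

Lemma indep_on_zip (P : pred T) (F : T -> V) xs s :
  indep_on P F -> uniq s -> all P s -> size xs = size s ->
  \sum_(t <- zip xs s) t.1 *: F t.2 = 0 -> all (eq_op^~ 0) xs.
Proof.
case: s => [|x0 s'] indF; first by move=> _ _ /size0nil ->.
set s := x0 :: s' => us Ps szs sum0.
(* Outside [s] the index is out of range and the default value 0 is the coefficient. *)
pose c x := xs`_(index x s).
have : \sum_(x | P x) c x *: F x = 0.
  rewrite (bigID (fun x => x \in s)) /= [X in _ + X]big1 ?addr0; last first.
    move=> x /andP[_ xs0]; rewrite /c nth_default ?scale0r // szs.
    by rewrite leqNgt index_mem.
  rewrite -[RHS]sum0 (eq_bigl (fun x => x \in s)); last first.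
    move=> x; have [xins|] := boolP (x \in s); last by rewrite andbF.
    by rewrite (allP Ps _ xins).
  rewrite -big_uniq // (big_nth x0) [RHS](big_nth (0, x0)) size_zip szs minnn.
  apply: eq_big_nat => i /andP[_ il].
  by rewrite nth_zip //= /c index_uniq.
move=> /indF c0; apply/(all_nthP 0) => i; rewrite szs => il; apply/eqP.
by rewrite -[RHS](c0 (nth x0 s i)) ?(allP Ps) ?mem_nth // /c index_uniq.
Qed.
End indep_on.

Lemma lin_indepP (K : nzRingType) (V : lmodType K) (T : finType) (F : T -> V) :
  lin_indep F <-> indep_on predT F.
Proof. by split=> H c c0 x => [_|]; apply: (H c c0). Qed.


Lemma Sk_indepP (K : comNzRingType) (V : comAlgType K) l k (S1 : 'I_l -> V) :
  lin_indep (Sk (k := k) S1) <->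
  indep_on (fun A : {set 'I_l} => #|A| == k) (fun A => \prod_(i in A) S1 i).
Proof.
have sumE (G : {set 'I_l} -> V) :
    \sum_(A : {set 'I_l} | #|A| == k) G A = \sum_(B : ksubset l k) G (val B).
  rewrite (@reindex_omap _ _ _ _ (ksubset l k) val insub) => [|A kA]; last by rewrite insubT.
  by apply: eq_bigl => B; rewrite valK eqxx andbT (valP B).
split=> H c c0.
  move=> A kA; apply: (H (fun B => c (val B)) _ (exist _ A kA)).
  by rewrite -[RHS]c0 sumE.
move=> B; pose d A := if insub A is Some B then c B else 0.
have dE A : d (val A) = c A by rewrite /d valK.
rewrite -dE; apply: (H d _ (val B) (valP B)).
by rewrite sumE -[RHS]c0; apply: eq_bigr => A _; rewrite dE.
Qed.

(** * Linear forms as points, and collinearity as linear dependence *)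

Definition o0 : 'I_3 := ord0.
Definition o1 : 'I_3 := lift ord0 ord0.
Definition o2 : 'I_3 := lift ord0 (lift ord0 ord0).

Lemma ord3P (i : 'I_3) : [\/ i = o0, i = o1 | i = o2].
Proof.
case: i => -[|[|[|//]]] ?; [constructor 1|constructor 2|constructor 3];
  exact: val_inj.
Qed.

Definition coords (K : comNzRingType) (v : 'rV[K]_3) : K * K * K :=
  (v 0 o0, v 0 o1, v 0 o2).

Definition points (K : comNzRingType) (a : 'M[K]_3) (k : 'I_6) : K * K * K :=
  coords (row (k : 'I_(3 + 3)) (col_mx 1%:M a)).

(** Constants lifted to polynomials, so that bracket identities over an arbitrary commutative ring
    apply at the generic point [mpoly_vars]. *)
Definition mpoly_vec (K : comNzRingType) (u : K * K * K) :
    {mpoly K[3]} * {mpoly K[3]} * {mpoly K[3]} :=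
  (u.1.1%:MP, u.1.2%:MP, u.2%:MP).
Definition mpoly_vars (K : comNzRingType) :
    {mpoly K[3]} * {mpoly K[3]} * {mpoly K[3]} :=
  ('X_o0, 'X_o1, 'X_o2).
Definition linform (K : comNzRingType) (u : K * K * K) : {mpoly K[3]} :=
  dot (mpoly_vec u) (mpoly_vars K).

Lemma S1_famE (K : comNzRingType) (a : 'M[K]_3) k :
  S1_fam a k = linform (points a k) ^+ 2.
Proof.
rewrite /S1_fam /points /linform /dot /coords /= !mxE.
case: (split _) => i; rewrite ?mxE.
  by case: (ord3P i) => ->; rewrite ?(mpolyC0, mpolyC1, mul0r, mul1r, addr0, add0r).
by rewrite /lin_forms !big_ord_recl big_ord0 addr0 -!mul_mpolyC !addrA.
Qed.

Lemma meval_linform (K : comNzRingType) (u z : K * K * K) :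
  (linform u).@[fun i : 'I_3 => nth 0 [:: z.1.1; z.1.2; z.2] i] = dot u z.
Proof. by rewrite /linform /dot /= !(mevalD, mevalM, mevalC, mevalXU). Qed.

Lemma bracket_mpoly_vec (K : comNzRingType) (u v w : K * K * K) :
  bracket (mpoly_vec u) (mpoly_vec v) (mpoly_vec w) = (bracket u v w)%:MP.
Proof. by rewrite /bracket /=; ring. Qed.

Definition lincomb_eq0 (K : comNzRingType) (x y z : K) (u v w : K * K * K) :=
  [/\ x * u.1.1 + y * v.1.1 + z * w.1.1 = 0,
      x * u.1.2 + y * v.1.2 + z * w.1.2 = 0 &
      x * u.2 + y * v.2 + z * w.2 = 0].

Lemma lincomb_bracket (K : fieldType) (x y z : K) (u v w : K * K * K) :
  lincomb_eq0 x y z u v w -> [|| x != 0, y != 0 | z != 0] -> bracket u v w = 0.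
Proof.
case=> E1 E2 E3 nz.
have X : x * bracket u v w = 0.
  transitivity (bracket (x * u.1.1 + y * v.1.1 + z * w.1.1,
    x * u.1.2 + y * v.1.2 + z * w.1.2, x * u.2 + y * v.2 + z * w.2) v w).
    by rewrite /bracket /=; ring.
  by rewrite E1 E2 E3 /bracket /= !mul0r subrr addr0.
have Y : y * bracket u v w = 0.
  transitivity (bracket u (x * u.1.1 + y * v.1.1 + z * w.1.1,
    x * u.1.2 + y * v.1.2 + z * w.1.2, x * u.2 + y * v.2 + z * w.2) w).
    by rewrite /bracket /=; ring.
  by rewrite E1 E2 E3 /bracket /= !mul0r !subrr !mulr0 subrr addr0.
have Z : z * bracket u v w = 0.
  transitivity (bracket u v (x * u.1.1 + y * v.1.1 + z * w.1.1,
    x * u.1.2 + y * v.1.2 + z * w.1.2, x * u.2 + y * v.2 + z * w.2)).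
    by rewrite /bracket /=; ring.
  by rewrite E1 E2 E3 /bracket /= !mulr0 !subrr !mulr0 subrr addr0.
by case/or3P: nz => nz; apply: (mulfI nz); rewrite mulr0.
Qed.

Lemma bracket_lincomb (K : fieldType) (u v w : K * K * K) : bracket u v w = 0 ->
  exists x y z, lincomb_eq0 x y z u v w /\ [|| x != 0, y != 0 | z != 0].
Proof.
case: u => [[u1 u2] u3]; case: v => [[v1 v2] v3]; case: w => [[w1 w2] w3].
rewrite /bracket /lincomb_eq0 /= => B.
have [N1|N1] := eqVneq (u2 * v3 - u3 * v2) 0; last first.
  (* Cofactors of one coordinate: the combination is the bracket in that coordinate and vanishes
     identically in the other two. *)
  exists (v2 * w3 - v3 * w2), (w2 * u3 - w3 * u2), (u2 * v3 - u3 * v2).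
  rewrite N1 !orbT; by do !split; first [ring | rewrite -[RHS]B; ring].
have [N2|N2] := eqVneq (u3 * v1 - u1 * v3) 0; last first.
  exists (v3 * w1 - v1 * w3), (w3 * u1 - w1 * u3), (u3 * v1 - u1 * v3).
  rewrite N2 !orbT; by do !split; first [ring | rewrite -[RHS]B; ring].
have [N3|N3] := eqVneq (u1 * v2 - u2 * v1) 0; last first.
  exists (v1 * w2 - v2 * w1), (w1 * u2 - w2 * u1), (u1 * v2 - u2 * v1).
  rewrite N3 !orbT; by do !split; first [ring | rewrite -[RHS]B; ring].
(* All 2 x 2 minors of u and v vanish, so a nonzero coordinate of u exhibits u and v as dependent;
   if u = 0 the coefficients 1, 0, 0 work. *)
have [U1|U1] := eqVneq u1 0; last first.
  exists (- v1), u1, 0; rewrite U1 orbT; do !split; first by ring.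
    by rewrite -[RHS]N3; ring.
  by apply: oppr_inj; rewrite oppr0 -[RHS]N2; ring.
have [U2|U2] := eqVneq u2 0; last first.
  exists (- v2), u2, 0; rewrite U2 orbT; do !split; last by rewrite -[RHS]N1; ring.
    by apply: oppr_inj; rewrite oppr0 -[RHS]N3; ring.
  by ring.
have [U3|U3] := eqVneq u3 0; last first.
  exists (- v3), u3, 0; rewrite U3 orbT; do !split; last by ring.
    by rewrite -[RHS]N2; ring.
  by apply: oppr_inj; rewrite oppr0 -[RHS]N1; ring.
by exists 1, 0, 0; rewrite oner_neq0 U1 U2 U3; do !split; ring.
Qed.

Lemma linform_lincomb (K : comNzRingType) (x y z : K) (u v w : K * K * K) :
  lincomb_eq0 x y z u v w ->
  x%:MP * linform u + y%:MP * linform v + z%:MP * linform w = 0.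
Proof.
case=> E1 E2 E3; rewrite /linform /dot /=.
transitivity ((x * u.1.1 + y * v.1.1 + z * w.1.1)%:MP * 'X_o0
  + (x * u.1.2 + y * v.1.2 + z * w.1.2)%:MP * 'X_o1
  + (x * u.2 + y * v.2 + z * w.2)%:MP * 'X_o2 : {mpoly K[3]}).
  ring.
by rewrite E1 E2 E3 !mpolyC0 !mul0r !addr0.
Qed.

(** If u and v are independent, the four forms lie in their span, and squares of such forms lie in
    the 3-dimensional space of U^2, UV, V^2. The coefficients are made explicit case by case. *)
Lemma collinear4_squares (K : fieldType) (u v w x : K * K * K) :
  bracket u v w = 0 -> bracket u v x = 0 ->
  exists2 s : seq K, size s = 4%N & ~~ all (eq_op^~ 0) s /\
    s`_0 *: linform u ^+ 2 + s`_1 *: linform v ^+ 2 + s`_2 *: linform w ^+ 2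
    + s`_3 *: linform x ^+ 2 = 0.
Proof.
move=> /bracket_lincomb[a1 [a2 [a3 [/linform_lincomb A nza]]]].
move=> /bracket_lincomb[b1 [b2 [b3 [/linform_lincomb B nzb]]]].
move: A B; set U := linform u; set V := linform v; set W := linform w.
set X := linform x => A B.
(* Here U and V are already dependent, and a difference of squares relates U^2 to V^2. *)
have par c1 c2 c3 (Y S T : {mpoly K[3]}) :
    c1%:MP * U + c2%:MP * V + c3%:MP * Y = 0 -> c3 = 0 ->
    c1 ^+ 2 *: U ^+ 2 + (- c2 ^+ 2) *: V ^+ 2 + 0 *: S + 0 *: T = 0.
  move=> + c30; rewrite c30 mpolyC0 mul0r addr0 => E; rewrite -!mul_mpolyC.
  transitivity ((c1%:MP * U - c2%:MP * V) * (c1%:MP * U + c2%:MP * V)); first by ring.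
  by rewrite E mulr0.
have [a30|a30] := eqVneq a3 0.
  exists [:: a1 ^+ 2; - a2 ^+ 2; 0; 0] => //=; split.
    by move: nza; rewrite a30 !eqxx oppr_eq0 !sqrf_eq0 /= orbF negb_and !andbT.
  exact: par A a30.
have [b30|b30] := eqVneq b3 0.
  exists [:: b1 ^+ 2; - b2 ^+ 2; 0; 0] => //=; split.
    by move: nzb; rewrite b30 !eqxx oppr_eq0 !sqrf_eq0 /= orbF negb_and !andbT.
  exact: par B b30.
have sqr c1 c2 c3 (Y : {mpoly K[3]}) : c1%:MP * U + c2%:MP * V + c3%:MP * Y = 0 ->
  (c3 ^+ 2)%:MP * Y ^+ 2 = (c1 ^+ 2)%:MP * U ^+ 2 + (2%:R * c1 * c2)%:MP * U * V
    + (c2 ^+ 2)%:MP * V ^+ 2.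
  move=> E; transitivity ((c1%:MP * U + c2%:MP * V) ^+ 2); last by ring.
  have -> : c1%:MP * U + c2%:MP * V = - (c3%:MP * Y).
    by apply/eqP; rewrite -addr_eq0 E.
  by ring.
have [a120|a120] := eqVneq (a1 * a2) 0.
  exists [:: - a1 ^+ 2; - a2 ^+ 2; a3 ^+ 2; 0] => //=; split.
    by rewrite !sqrf_eq0 (negbTE a30) !andbF.
  rewrite scale0r addr0 -!mul_mpolyC (sqr _ _ _ _ A).
  have -> : 2%:R * a1 * a2 = 0 by rewrite -mulrA a120 mulr0.
  rewrite mpolyC0.
  by ring.
(* Eliminates UV between the expansions of (a3 W)^2 and (b3 X)^2. *)
exists [:: b1 * b2 * a1 ^+ 2 - a1 * a2 * b1 ^+ 2; b1 * b2 * a2 ^+ 2 - a1 * a2 * b2 ^+ 2;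
  - (b1 * b2 * a3 ^+ 2); a1 * a2 * b3 ^+ 2] => //=; split.
  have nz : a1 * a2 * b3 ^+ 2 != 0 by rewrite mulf_neq0 ?expf_neq0.
  by rewrite (negbTE nz) !andbF.
rewrite -!mul_mpolyC.
transitivity ((b1 * b2 * a1 ^+ 2 - a1 * a2 * b1 ^+ 2)%:MP * U ^+ 2
  + (b1 * b2 * a2 ^+ 2 - a1 * a2 * b2 ^+ 2)%:MP * V ^+ 2
  - (b1 * b2)%:MP * ((a3 ^+ 2)%:MP * W ^+ 2) + (a1 * a2)%:MP * ((b3 ^+ 2)%:MP * X ^+ 2)).
  by ring.
by rewrite (sqr _ _ _ _ A) (sqr _ _ _ _ B); ring.
Qed.

(** * The conic determinant and the identity behind both directions *)

Definition pair_products (K : comNzRingType) (u : K * K * K) : K * K * K :=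
  (u.1.2 * u.2, u.1.1 * u.2, u.1.1 * u.1.2).

(** Conics through the three coordinate points are spanned by yz, xz, xy; this determinant vanishes
    exactly when one of them passes through u, v, w. *)
Definition conic_det (K : comNzRingType) (u v w : K * K * K) : K :=
  bracket (pair_products u) (pair_products v) (pair_products w).

(** The identity of the opening comment with three points at the coordinate vectors, checked by
    expansion. The arbitrary ring allows its use at scalars and at polynomials. *)
Lemma split_sum_coord (K : comNzRingType) (u v w z : K * K * K) :
  split_sum (split_term z) (1, 0, 0) (0, 1, 0) (0, 0, 1) u v w =
  6%:R * conic_det u v w *
    (z.1.1 * z.1.2 * z.2 * (dot u z * dot v z * dot w z)).
Proof.
case: u => [[u1 u2] u3]; case: v => [[v1 v2] v3]; case: w => [[w1 w2] w3].
case: z => [[x y] z].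
rewrite /conic_det /split_sum /split_term /bracket /dot /=.
ring.
Qed.

Definition p0 : 'I_6 := lshift 3 o0.
Definition p1 : 'I_6 := lshift 3 o1.
Definition p2 : 'I_6 := lshift 3 o2.
Definition p3 : 'I_6 := rshift 3 o0.
Definition p4 : 'I_6 := rshift 3 o1.
Definition p5 : 'I_6 := rshift 3 o2.

Lemma points_uniq : uniq [:: p0; p1; p2; p3; p4; p5].
Proof. by []. Qed.

Lemma pointsE (K : comNzRingType) (a : 'M[K]_3) :
  (points a p0 = (1, 0, 0)) * (points a p1 = (0, 1, 0)) * (points a p2 = (0, 0, 1))
  * (points a p3 = coords (row o0 a)) * (points a p4 = coords (row o1 a))
  * (points a p5 = coords (row o2 a)).
Proof.
rewrite /points /p0 /p1 /p2 /p3 /p4 /p5.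
by rewrite !(rowKu, rowKd) /coords !mxE.
Qed.

Lemma sum_points (V : nmodType) (F : 'I_6 -> V) :
  \sum_k F k = F p0 + F p1 + F p2 + F p3 + F p4 + F p5.
Proof.
rewrite -(eq_bigl _ _ (fun k => mem_all6 k points_uniq)) -big_uniq //.
by rewrite !big_cons big_nil /= addr0 !addrA.
Qed.

(** On the curve (1, t, t^2) a nonzero form restricts to a nonzero polynomial in t, and the
    coordinates multiply to t^3. *)
Lemma mul_dot_eq0 (K : numFieldType) (c : K) (u v w : K * K * K) :
  u != 0 -> v != 0 -> w != 0 ->
  (forall z, c * (z.1.1 * z.1.2 * z.2 * (dot u z * dot v z * dot w z)) = 0) ->
  c = 0.
Proof.
pose q (t : K * K * K) : {poly K} := t.1.1%:P + t.1.2%:P * 'X + t.2%:P * 'X^2.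
have q0 t : t != 0 -> q t != 0.
  apply: contra => /eqP qt; have E i : (q t)`_i = 0 by rewrite qt coef0.
  move: (E 0%N) (E 1%N) (E 2%N); rewrite !coefD !coefMX !coefC !coefMXn !coefC /=.
  rewrite !(addr0, add0r).
  by case: t {qt E} => [[? ?] ?] /= -> -> ->.
move=> /q0 u0 /q0 v0 /q0 w0 H.
have : c%:P * ('X^3 * (q u * q v * q w)) = 0.
  apply: poly_eval_eq0 => t; rewrite -[RHS](H (1, t, t ^+ 2)) /q /dot /=.
  by rewrite !(hornerM, hornerD, hornerC, hornerX, hornerXn); ring.
move=> /eqP; rewrite mulf_eq0 polyC_eq0 => /orP[/eqP //|].
have X3 : 'X^3 != 0 :> {poly K} by rewrite expf_neq0 // polyX_eq0.
by rewrite (negbTE (mulf_neq0 X3 (mulf_neq0 (mulf_neq0 u0 v0) w0))).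
Qed.

(** The signed sum is alternating in the six points, so an even rearrangement preserves it; each
    instance is checked by expansion. *)
Ltac even_arrangement z :=
  rewrite !pointsE split_sum_coord; case: z => [[? ?] ?];
  move: (coords _) (coords _) (coords _) => [[? ?] ?] [[? ?] ?] [[? ?] ?];
  rewrite /conic_det /split_sum /split_term /bracket /dot /=; ring.

Ltac generalize_brackets :=
  repeat match goal with |- context [bracket ?u ?v ?w] =>
    move: (bracket u v w) => ? end;
  repeat match goal with |- context [linform ?u] => move: (linform u) => ? end.

(** * Sums over the twenty triples of the six points *)

Section main.
Variables (K : numFieldType) (a : 'M[K]_3).
Local Notation l := (points a).
Local Notation b i j k := (bracket (l i) (l j) (l k)).
Local Notation D := (conic_det (l p3) (l p4) (l p5)).

Lemma ksubsets_points i j m n p q : uniq [:: i; j; m; n; p; q] ->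
  let s := ksubsets 3 [:: i; j; m; n; p; q] in
  uniq s /\ forall A : {set 'I_6}, (A \in s) = (#|A| == 3%N).
Proof.
move=> U; split; first exact: ksubsets_uniq.
move=> A; rewrite mem_ksubsets // (_ : A \subset _) //.
by apply/subsetP => x _; apply: mem_all6.
Qed.

Lemma prod_tri (R : comNzRingType) (F : 'I_6 -> R) i j k :
  uniq [:: i; j; k] -> \prod_(x in tri i j k) F x = F i * F j * F k.
Proof.
rewrite /= !inE negb_or andbT => /andP[/andP[ij ik] jk].
rewrite /tri !big_setU1 ?inE ?orbF ?negb_or ?ij ?ik ?jk //.
by rewrite big_set0 /= mulr1 mulrA.
Qed.

Lemma sum_ksubsets (R : comNzRingType) (c : {set 'I_6} -> R) (F : 'I_6 -> R)
    i j m n p q : uniq [:: i; j; m; n; p; q] ->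
  \sum_(A <- ksubsets 3 [:: i; j; m; n; p; q]) c A * \prod_(x in A) F x =
  cubic (fun x y z => c (tri x y z)) F i j m n p q.
Proof.
move=> U; rewrite /= !big_cons big_nil -!/(tri _ _ _).
move: U; rewrite /= !inE !negb_or -!andbA.
do 15![case/andP => ?]; move=> _.
rewrite !prod_tri; try by rewrite /= !inE !negb_or; do ![apply/andP; split].
rewrite /cubic; ring.
Qed.

(** * Consequences of the independence of the squares *)

Section squares.
Hypothesis squares_free : indep_on predT (S1_fam a).

Lemma squares_not_collinear4 i j k m : uniq [:: i; j; k; m] ->
  b i j k = 0 -> b i j m != 0.
Proof.
move=> U bk; apply/eqP => bm.
have [s sz [nz E]] := collinear4_squares bk bm.
apply: (negP nz); apply: (indep_on_zip squares_free U) => //.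
case: s sz nz E => [|s0 [|s1 [|s2 [|s3 [|]]]]] //= _ _ E.
have addrA4 (V : zmodType) (x y z t : V) : x + (y + (z + t)) = x + y + z + t.
  by rewrite !addrA.
by rewrite !big_cons big_nil addr0 !S1_famE; apply: etrans (addrA4 _ _ _ _ _) E.
Qed.

Lemma points_neq0 k : l k != 0.
Proof.
apply/eqP => lk.
have /(_ _ _) := indep_on_zip (xs := [:: 1]) (s := [:: k]) squares_free.
rewrite big_cons big_nil S1_famE lk /linform /dot /= mpolyC0 !mul0r !addr0.
by rewrite expr0n scaler0 oner_eq0 => /(_ isT isT erefl erefl).
Qed.

(** A dependency among the rows of D combines the last three squares without mixed monomials; the
    rest is cancelled by the squares of the variables. *)
Lemma conic_det_neq0 : D != 0.
Proof.
apply/eqP => /bracket_lincomb[x [y [z [[/= E1 E2 E3] nz]]]].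
apply: (negP (_ : ~~ all (eq_op^~ 0) [:: x; y; z])).
  by move: nz; rewrite /= andbT !negb_and.
pose d u := x * u (l p3) ^+ 2 + y * u (l p4) ^+ 2 + z * u (l p5) ^+ 2.
have := indep_on_zip (xs := [:: - d (fun t => t.1.1); - d (fun t => t.1.2); - d snd; x; y; z])
  squares_free points_uniq.
move=> /(_ _ erefl _)/and4P[||_ _ _]; [by [] | | by []].
rewrite !big_cons big_nil addr0 !S1_famE /= -!mul_mpolyC.
transitivity ((2%:R * (x * ((l p3).1.2 * (l p3).2) + y * ((l p4).1.2 * (l p4).2)
      + z * ((l p5).1.2 * (l p5).2)))%:MP * ('X_o1 * 'X_o2)
  + (2%:R * (x * ((l p3).1.1 * (l p3).2) + y * ((l p4).1.1 * (l p4).2)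
      + z * ((l p5).1.1 * (l p5).2)))%:MP * ('X_o0 * 'X_o2)
  + (2%:R * (x * ((l p3).1.1 * (l p3).1.2) + y * ((l p4).1.1 * (l p4).1.2)
      + z * ((l p5).1.1 * (l p5).1.2)))%:MP * ('X_o0 * 'X_o1) : {mpoly K[3]}).
  rewrite /linform /dot /d !pointsE /= mpolyC0 mpolyC1; ring.
by rewrite E1 E2 E3 !mulr0 mpolyC0 !mul0r !addr0.
Qed.
End squares.

Lemma triples_free_of_squares :
  indep_on predT (S1_fam a) ->
  indep_on (fun A : {set 'I_6} => #|A| == 3%N) (fun A => \prod_(i in A) S1_fam a i).
Proof.
move=> sf c c0.
have rel i j m n p q z : uniq [:: i; j; m; n; p; q] ->
    cubic (fun x y w => c (tri x y w)) (fun x => dot (l x) z ^+ 2) i j m n p q = 0.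
  move=> U; have [us ms] := ksubsets_points U.
  rewrite -sum_ksubsets // big_uniq //= (eq_bigl _ _ ms).
  pose v (i : 'I_3) := nth 0 [:: z.1.1; z.1.2; z.2] i.
  have := congr1 (meval v) c0; rewrite meval0 raddf_sum => E0; rewrite -[RHS]E0.
  apply: eq_bigr => A _.
  rewrite /= mevalZ rmorph_prod; congr (_ * _). apply: eq_bigr => x _.
  by rewrite /= S1_famE rmorphXn /= meval_linform.
have nc4 := squares_not_collinear4 sf.
(* For such an arrangement the weight of ijm times 6 D times the product of the six forms vanishes
   at every z, so the weight is zero. *)
have w0 i j m n p q : uniq [:: i; j; m; n; p; q] ->
    (forall z, split_sum (split_term z) (l i) (l j) (l m) (l n) (l p) (l q)
      = split_sum (split_term z) (l p0) (l p1) (l p2) (l p3) (l p4) (l p5)) ->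
    c (tri i j m) = 0 /\ c (tri n p q) = 0.
  move=> U sE.
  have w : weight l c i j m = 0.
    have nz := points_neq0 sf.
    apply: mul_dot_eq0 (nz p3) (nz p4) (nz p5) _ => z.
    have := weight_split_sum rel nc4 z U; rewrite sE !pointsE split_sum_coord -!pointsE.
    have D6 : 6%:R * D != 0 by rewrite mulf_neq0 ?pnatr_eq0 ?conic_det_neq0.
    by move=> E; apply: (mulfI D6); rewrite mulr0 -[RHS]E; ring.
  split; last by rewrite (weight_coef rel nc4 U) w mul0r.
  rewrite (@weight_coef _ _ _ rel nc4 n p q i j m); last by permute_uniq U.
  by rewrite (weight_opp rel nc4 U) w oppr0 mul0r.
(* Ten splits cover the twenty triples; the complements are ordered so that each arrangement is
   even. *)
have [e012 e345] : c (tri p0 p1 p2) = 0 /\ c (tri p3 p4 p5) = 0 by exact: w0.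
have [e013 e254] : c (tri p0 p1 p3) = 0 /\ c (tri p2 p5 p4) = 0.
  by apply: w0 => // z; even_arrangement z.
have [e014 e235] : c (tri p0 p1 p4) = 0 /\ c (tri p2 p3 p5) = 0.
  by apply: w0 => // z; even_arrangement z.
have [e015 e243] : c (tri p0 p1 p5) = 0 /\ c (tri p2 p4 p3) = 0.
  by apply: w0 => // z; even_arrangement z.
have [e023 e145] : c (tri p0 p2 p3) = 0 /\ c (tri p1 p4 p5) = 0.
  by apply: w0 => // z; even_arrangement z.
have [e024 e153] : c (tri p0 p2 p4) = 0 /\ c (tri p1 p5 p3) = 0.
  by apply: w0 => // z; even_arrangement z.
have [e025 e134] : c (tri p0 p2 p5) = 0 /\ c (tri p1 p3 p4) = 0.
  by apply: w0 => // z; even_arrangement z.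
have [e034 e125] : c (tri p0 p3 p4) = 0 /\ c (tri p1 p2 p5) = 0.
  by apply: w0 => // z; even_arrangement z.
have [e035 e142] : c (tri p0 p3 p5) = 0 /\ c (tri p1 p4 p2) = 0.
  by apply: w0 => // z; even_arrangement z.
have [e045 e123] : c (tri p0 p4 p5) = 0 /\ c (tri p1 p2 p3) = 0.
  by apply: w0 => // z; even_arrangement z.
move=> A; have [_ <-] := ksubsets_points points_uniq; move: A.
suff /allP c_eq0 : all (fun A => c A == 0) (ksubsets 3 [:: p0; p1; p2; p3; p4; p5]).
  by move=> A /c_eq0 /eqP.
rewrite /= -!/(tri _ _ _).
rewrite e012 e013 e014 e015 e023 e024 e025 e034 e035 e045.
rewrite (triAC p1 p2 p4) (triAC p1 p3 p5) (triAC p2 p3 p4) (triAC p2 p4 p5).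
by rewrite e123 e142 e125 e134 e153 e145 e243 e235 e254 e345 !eqxx.
Qed.

(** * Consequences of the independence of the triple products *)

Section triples.
Hypothesis triples_free :
  indep_on (fun A : {set 'I_6} => #|A| == 3%N) (fun A => \prod_(i in A) S1_fam a i).

Lemma triples_coef_eq0 i j m n p q x0 x1 x2 x3 x4 x5 x6 x7 x8 x9
    x10 x11 x12 x13 x14 x15 x16 x17 x18 x19 :
  uniq [:: i; j; m; n; p; q] ->
    x0%:MP * (S1_fam a i * S1_fam a j * S1_fam a m) +
    x1%:MP * (S1_fam a i * S1_fam a j * S1_fam a n) +
    x2%:MP * (S1_fam a i * S1_fam a j * S1_fam a p) +
    x3%:MP * (S1_fam a i * S1_fam a j * S1_fam a q) +
    x4%:MP * (S1_fam a i * S1_fam a m * S1_fam a n) +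
    x5%:MP * (S1_fam a i * S1_fam a m * S1_fam a p) +
    x6%:MP * (S1_fam a i * S1_fam a m * S1_fam a q) +
    x7%:MP * (S1_fam a i * S1_fam a n * S1_fam a p) +
    x8%:MP * (S1_fam a i * S1_fam a n * S1_fam a q) +
    x9%:MP * (S1_fam a i * S1_fam a p * S1_fam a q) +
    x10%:MP * (S1_fam a j * S1_fam a m * S1_fam a n) +
    x11%:MP * (S1_fam a j * S1_fam a m * S1_fam a p) +
    x12%:MP * (S1_fam a j * S1_fam a m * S1_fam a q) +
    x13%:MP * (S1_fam a j * S1_fam a n * S1_fam a p) +
    x14%:MP * (S1_fam a j * S1_fam a n * S1_fam a q) +
    x15%:MP * (S1_fam a j * S1_fam a p * S1_fam a q) +
    x16%:MP * (S1_fam a m * S1_fam a n * S1_fam a p) +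
    x17%:MP * (S1_fam a m * S1_fam a n * S1_fam a q) +
    x18%:MP * (S1_fam a m * S1_fam a p * S1_fam a q) +
    x19%:MP * (S1_fam a n * S1_fam a p * S1_fam a q) = 0 ->
  all (eq_op^~ 0) [:: x0; x1; x2; x3; x4; x5; x6; x7; x8; x9;
    x10; x11; x12; x13; x14; x15; x16; x17; x18; x19].
Proof.
move=> U E; have [us ms] := ksubsets_points U.
apply: (indep_on_zip triples_free us) => //.
  by apply/allP => A; rewrite ms.
rewrite -[RHS]E /= !big_cons big_nil -!/(tri _ _ _) /=.
move: U; rewrite /= !inE !negb_or -!andbA.
do 15![case/andP => ?]; move=> _.
rewrite !prod_tri; try by rewrite /= !inE !negb_or; do ![apply/andP; split].
rewrite -!mul_mpolyC; ring.
Qed.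

Lemma triples_not_collinear4 i j k m p q : uniq [:: i; j; k; m; p; q] ->
  b i j k = 0 -> b i j m != 0.
Proof.
move=> U bk; apply/eqP => bm.
have [s sz [nz E]] := collinear4_squares bk bm.
case: s sz nz E => [|s0 [|s1 [|s2 [|s3 [|]]]]] //= _ /negP nz.
move=> E; apply: nz.
(* The dependency among the four squares is multiplied by the squares of l_p and l_q, so its
   coefficients sit at the triples containing p and q. *)
have := @triples_coef_eq0 i j k m p q 0 0 0 0 0 0 0 0 0 s0 0 0 0 0 0 s1 0 0 s2 s3 U.
rewrite !mpolyC0 => /(_ _)/and5P[].
  rewrite !S1_famE; move: (linform (l i)) (linform (l j)) (linform (l k)) (linform (l p))
    (linform (l q)) (linform (l m)) E.
  move=> Li Lj Lk Lp Lq Lm E.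
  transitivity ((s0 *: Li ^+ 2 + s1 *: Lj ^+ 2 + s2 *: Lk ^+ 2
    + s3 *: Lm ^+ 2) * (Lp ^+ 2 * Lq ^+ 2)).
    by rewrite -!mul_mpolyC; ring.
  by rewrite E mul0r.
do 4!move=> _; do 5![case/andP => _]; case/andP=> ->.
by do 5![case/andP => _]; case/andP => ->; do 2![case/andP => _].
Qed.

Lemma triples_conic_det_neq0 : D != 0.
Proof.
apply/eqP => D0.
(* The coefficients of the identity, read at the generic point, where D = 0 makes the sum vanish. *)
have := @triples_coef_eq0 p0 p1 p2 p3 p4 p5
  (- (b p0 p1 p2 * b p3 p4 p5 ^+ 3))
  (b p0 p1 p3 * b p2 p4 p5 ^+ 3)
  (- (b p0 p1 p4 * b p2 p3 p5 ^+ 3))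
  (b p0 p1 p5 * b p2 p3 p4 ^+ 3)
  (- (b p0 p2 p3 * b p1 p4 p5 ^+ 3))
  (b p0 p2 p4 * b p1 p3 p5 ^+ 3)
  (- (b p0 p2 p5 * b p1 p3 p4 ^+ 3))
  (- (b p0 p3 p4 * b p1 p2 p5 ^+ 3))
  (b p0 p3 p5 * b p1 p2 p4 ^+ 3)
  (- (b p0 p4 p5 * b p1 p2 p3 ^+ 3))
  (b p0 p4 p5 ^+ 3 * b p1 p2 p3)
  (- (b p0 p3 p5 ^+ 3 * b p1 p2 p4))
  (b p0 p3 p4 ^+ 3 * b p1 p2 p5)
  (b p0 p2 p5 ^+ 3 * b p1 p3 p4)
  (- (b p0 p2 p4 ^+ 3 * b p1 p3 p5))
  (b p0 p2 p3 ^+ 3 * b p1 p4 p5)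
  (- (b p0 p1 p5 ^+ 3 * b p2 p3 p4))
  (b p0 p1 p4 ^+ 3 * b p2 p3 p5)
  (- (b p0 p1 p3 ^+ 3 * b p2 p4 p5))
  (b p0 p1 p2 ^+ 3 * b p3 p4 p5) points_uniq.
move=> /(_ _)/and4P[].
  transitivity (split_sum (split_term (mpoly_vars K)) (mpoly_vec (l p0)) (mpoly_vec (l p1))
      (mpoly_vec (l p2)) (mpoly_vec (l p3)) (mpoly_vec (l p4)) (mpoly_vec (l p5))).
    by rewrite /split_sum /split_term !bracket_mpoly_vec !S1_famE -!/(linform _);
      generalize_brackets; ring.
  have e1 : mpoly_vec (l p0) = (1, 0, 0) by rewrite pointsE /mpoly_vec mpolyC0 mpolyC1.
  have e2 : mpoly_vec (l p1) = (0, 1, 0) by rewrite pointsE /mpoly_vec mpolyC0 mpolyC1.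
  have e3 : mpoly_vec (l p2) = (0, 0, 1) by rewrite pointsE /mpoly_vec mpolyC0 mpolyC1.
  have det_mpoly u v w : conic_det (mpoly_vec u) (mpoly_vec v) (mpoly_vec w)
      = (conic_det u v w)%:MP.
    by rewrite /conic_det /pair_products /bracket /=; ring.
  by rewrite e1 e2 e3 split_sum_coord det_mpoly D0 mpolyC0 mulr0 mul0r.
(* All coefficients are now zero. Since [012] = 1, points 3, 4, 5 are collinear, so [245] and [235]
   are nonzero; then [013] = [014] = 0 puts 0, 1, 3, 4 on one line. *)
have b012 : b p0 p1 p2 = 1 by rewrite !pointsE /bracket /=; ring.
rewrite b012 mul1r oppr_eq0 expf_eq0 /= => /eqP b345 E013.
rewrite oppr_eq0 => E014 _.
have b245 : b p2 p4 p5 != 0.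
  rewrite -bracket_rot; apply: (@triples_not_collinear4 p4 p5 p3 p2 p0 p1) => //.
  by rewrite bracket_rot.
have b235 : b p2 p3 p5 != 0.
  rewrite -bracket_rot; apply: (@triples_not_collinear4 p3 p5 p4 p2 p0 p1) => //.
  by rewrite bracketAC b345 oppr0.
have b013 : b p0 p1 p3 = 0.
  by apply/eqP; move: E013; rewrite mulf_eq0 (negbTE (expf_neq0 3 b245)) orbF.
have /eqP[] : b p0 p1 p4 != 0.
  exact: (@triples_not_collinear4 p0 p1 p3 p4 p2 p5).
by apply/eqP; move: E014; rewrite mulf_eq0 (negbTE (expf_neq0 3 b235)) orbF.
Qed.

Lemma squares_free_of_triples : indep_on predT (S1_fam a).
Proof.
move=> c c0.
have Q0 (z : K * K * K) : \sum_k c k * dot (l k) z ^+ 2 = 0.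
  pose v (i : 'I_3) := nth 0 [:: z.1.1; z.1.2; z.2] i.
  have := congr1 (meval v) c0; rewrite meval0 raddf_sum => E0; rewrite -[RHS]E0.
  by apply: eq_bigr => k _; rewrite /= mevalZ S1_famE rmorphXn /= meval_linform.
have Q (z : K * K * K) : c p0 * z.1.1 ^+ 2 + c p1 * z.1.2 ^+ 2 + c p2 * z.2 ^+ 2
    + c p3 * dot (l p3) z ^+ 2 + c p4 * dot (l p4) z ^+ 2 + c p5 * dot (l p5) z ^+ 2 = 0.
  rewrite -[RHS](Q0 z) sum_points.
  have d0 : dot (l p0) z = z.1.1 by rewrite pointsE /dot /=; ring.
  have d1 : dot (l p1) z = z.1.2 by rewrite pointsE /dot /=; ring.
  have d2 : dot (l p2) z = z.2 by rewrite pointsE /dot /=; ring.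
  by rewrite d0 d1 d2.
have sub3 (x y z : K) : x = 0 -> y = 0 -> z = 0 -> x - y - z = 0.
  by move=> -> -> ->; rewrite !subr0.
have two_neq0 : 2%:R != 0 :> K by rewrite pnatr_eq0.
have lin : lincomb_eq0 (c p3) (c p4) (c p5) (pair_products (l p3))
    (pair_products (l p4)) (pair_products (l p5)).
  (* Polarization: evaluating at a sum of two unit vectors and subtracting the values at each
     isolates twice the mixed coefficient, hence a relation among the rows of D. *)
  split; apply: (mulfI two_neq0); rewrite mulr0 /pair_products /=.
  - rewrite -[RHS](sub3 _ _ _ (Q (0, 1, 1)) (Q (0, 1, 0)) (Q (0, 0, 1))) /dot /=; ring.
  - rewrite -[RHS](sub3 _ _ _ (Q (1, 0, 1)) (Q (1, 0, 0)) (Q (0, 0, 1))) /dot /=; ring.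
  - rewrite -[RHS](sub3 _ _ _ (Q (1, 1, 0)) (Q (1, 0, 0)) (Q (0, 1, 0))) /dot /=; ring.
have [nz|] := boolP [|| c p3 != 0, c p4 != 0 | c p5 != 0].
  by case/eqP: triples_conic_det_neq0; apply: lincomb_bracket lin nz.
rewrite !negb_or !negbK => /and3P[/eqP c3 /eqP c4 /eqP c5].
have c012 : [/\ c p0 = 0, c p1 = 0 & c p2 = 0].
  split.
  - by rewrite -[RHS](Q (1, 0, 0)) c3 c4 c5 /=; ring.
  - by rewrite -[RHS](Q (0, 1, 0)) c3 c4 c5 /=; ring.
  - by rewrite -[RHS](Q (0, 0, 1)) c3 c4 c5 /=; ring.
case: c012 => c0' c1 c2 k _; have := mem_all6 k points_uniq.
by rewrite !inE => /or3P[|| /or4P[]] /eqP ->.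
Qed.
End triples.
End main.


(* C = R[i] with R : realType is the field of complex numbers. *)
Theorem theorem1p2 (R : realType) (a : 'M[R[i]]_3) :
  lin_indep (Sk (k := 3%N) (S1_fam a)) <-> lin_indep (S1_fam a).
Proof.
rewrite Sk_indepP lin_indepP; split.
  exact: squares_free_of_triples.
exact: triples_free_of_squares.
Qed.
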